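(* Let $\mathcal Q:\mathbb R_+^d\to\mathbb R_+^d$ be the joint quotation operator of a data–model coupled market (as defined in the context). Then $\mathcal Q$ is a standard interference function, i.e. it is positive, monotone and scalable. Consequently, if there exists $\bar{\mathbf p}\in\mathbb R_+^d$ with $\bar{\mathbf p}\ge \mathcal Q(\bar{\mathbf p})$ (componentwise), then a fixed point $\mathbf p^\star=\mathcal Q(\mathbf p^\star)$ exists in $\mathbb R_+^d$, it is unique, and for every initialization $\mathbf p^{(0)}\ge 0$ the iteration $\mathbf p^{(t+1)}=\mathcal Q(\mathbf p^{(t)})$, $t=0,1,2,\dots$, converges to $\mathbf p^\star$.
   Context: Market data: finitely many datasets $D_1,\dots,D_\ell$ and models $M_1,\dots,M_J$. Each model $M_j$ has a finite set $\mathcal D_{M_j}$ of datasets it uses (we write $i\in\mathcal D_{M_j}$ for $D_i\in\mathcal D_{M_j}$) and a finite set $\mathcal B_{M_j}$ of buyers ($k\in\mathcal B_{M_j}$ for $B_k\in\mathcal B_{M_j}$). Parameters: offsets $\kappa_{M_j}>0$ and $\kappa_{D_i}>0$; margins $\delta_{M_j}\ge 0$; Shapley weights $\mathrm{SV}_{i\mid j}\ge 0$ with $\sum_{i\in\mathcal D_{M_j}}\mathrm{SV}_{i\mid j}=1$ for each $j$; buyer weights $\omega_{jk}\ge 0$ with $\sum_{k\in\mathcal B_{M_j}}\omega_{jk}=\rho_j\in[0,1)$ for each $j$. A price vector $\mathbf p\in\mathbb R_+^d$, $d=\sum_j|\mathcal B_{M_j}|+\sum_j|\mathcal D_{M_j}|$,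 has one coordinate $p_{B_k\to M_j}$ for each $j$ and $k\in\mathcal B_{M_j}$, and one coordinate $p_{D_i\to M_j}$ for each $j$ and $i\in\mathcal D_{M_j}$. The joint quotation operator $\mathcal Q$ is defined by $$\mathcal Q(\mathbf p)_{B_k\to M_j}=\kappa_{M_j}+(1+\delta_{M_j})\sum_{i\in\mathcal D_{M_j}}p_{D_i\to M_j},$$ $$\mathcal Q(\mathbf p)_{D_i\to M_j}=\kappa_{D_i}+\frac{\mathrm{SV}_{i\mid j}}{1+\delta_{M_j}}\,W_j,\qquad W_j=\sum_{k\in\mathcal B_{M_j}}\omega_{jk}\,p_{B_k\to M_j}.$$ Definition: a mapping $T:\mathbb R_+^d\to\mathbb R_+^d$ is a standard interference function if for all $\mathbf x,\mathbf y\in\mathbb R_+^d$ and all $\alpha>1$: (positivity) $T(\mathbf x)\in\mathbb R_{++}^d$, i.e. all components are strictly positive; (monotonicity) $\mathbf x\ge\mathbf y$ implies $T(\mathbf x)\ge T(\mathbf y)$; (scalability) $\alpha T(\mathbf x)>T(\alpha\mathbf x)$. All vector inequalities are componentwise (strict inequality means strict in every component). *)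

(* Defs.v *)
From HB Require Import structures.
From mathcomp Require Import all_boot all_order all_algebra.
From mathcomp Require Import all_classical all_reals all_analysis.
Set Implicit Arguments.
Unset Strict Implicit.
Unset Printing Implicit Defensive.
Import Order.TTheory GRing.Theory Num.Theory.
Import numFieldNormedType.Exports.
Local Open Scope ring_scope.

Section Interference.
Variables (R : realType) (d : nat).
Implicit Types x y : 'rV[R]_d.

Definition vle x y : Prop := forall c, x ord0 c <= y ord0 c.

(* Strict in every coordinate, hence not the strict part of [vle]. *)
Definition vlt x y : Prop := forall c, x ord0 c < y ord0 c.

Definition positivity (T : 'rV[R]_d -> 'rV[R]_d) : Prop :=
  forall x, vle 0 x -> vlt 0 (T x).

Definition monotonicity (T : 'rV[R]_d -> 'rV[R]_d) : Prop :=
  forall x y, vle 0 x -> vle 0 y -> vle y x -> vle (T y) (T x).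

Definition scalability (T : 'rV[R]_d -> 'rV[R]_d) : Prop :=
  forall x (alpha : R), vle 0 x -> 1 < alpha ->
    vlt (T (alpha *: x)) (alpha *: T x).

(* A self-map of the orthant R_+^d is represented by a map on R^d whose values
   off the orthant are irrelevant; positivity makes the orthant stable. *)
Definition standard_interference_function (T : 'rV[R]_d -> 'rV[R]_d) : Prop :=
  [/\ positivity T, monotonicity T & scalability T].

End Interference.

(* [l] datasets, [J] models; buyers are labelled by ['I_K]. The values of
   [SV i j] for [i] outside [datasets j], and of [omega j k] for [k] outside
   [buyers j], are unconstrained and never used. *)
Record market (R : realType) (l J K : nat) := Market {
  datasets : 'I_J -> {set 'I_l};
  buyers : 'I_J -> {set 'I_K};
  kappaM : 'I_J -> R;
  kappaD : 'I_l -> R;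
  delta : 'I_J -> R;
  SV : 'I_l -> 'I_J -> R;
  omega : 'I_J -> 'I_K -> R;
  rho : 'I_J -> R;
  kappaM_gt0 : forall j, 0 < kappaM j;
  kappaD_gt0 : forall i, 0 < kappaD i;
  delta_ge0 : forall j, 0 <= delta j;
  SV_ge0 : forall j i, i \in datasets j -> 0 <= SV i j;
  SV_sum1 : forall j, \sum_(i in datasets j) SV i j = 1;
  omega_ge0 : forall j k, k \in buyers j -> 0 <= omega j k;
  omega_sum : forall j, \sum_(k in buyers j) omega j k = rho j;
  rho_ge0 : forall j, 0 <= rho j;
  rho_lt1 : forall j, rho j < 1
}.

Section Quotation.
Variables (R : realType) (l J K : nat) (m : market R l J K).

Definition buyer_of (j : 'I_J) : finType := {k : 'I_K | k \in buyers m j}.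
Definition dataset_of (j : 'I_J) : finType := {i : 'I_l | i \in datasets m j}.

(* [inl (j, k)] labels the coordinate B_k -> M_j and [inr (j, i)] the
   coordinate D_i -> M_j. *)
Definition link : finType :=
  ({j : 'I_J & buyer_of j} + {j : 'I_J & dataset_of j})%type.

Definition market_dim : nat := #|link|.

Lemma market_dimE :
  market_dim = (\sum_j #|buyers m j| + \sum_j #|datasets m j|)%N.
Proof.
rewrite /market_dim card_sum !card_tagged !sumnE !big_map -!big_enum /=.
by congr addn; apply: eq_bigr => j _; rewrite card_sig.
Qed.

Definition buyer_price (p : 'rV[R]_market_dim) (j : 'I_J) (k : buyer_of j) : R :=
  p ord0 (enum_rank (inl (Tagged buyer_of k) : link)).

Definition dataset_price (p : 'rV[R]_market_dim) (j : 'I_J) (i : dataset_of j) : R :=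
  p ord0 (enum_rank (inr (Tagged dataset_of i) : link)).

Definition W (p : 'rV[R]_market_dim) (j : 'I_J) : R :=
  \sum_(k : buyer_of j) omega m j (val k) * buyer_price p k.

Definition quotation (p : 'rV[R]_market_dim) : 'rV[R]_market_dim :=
  \row_(c < market_dim)
    match enum_val c : link with
    | inl (existT j _) =>
        kappaM m j + (1 + delta m j) * \sum_(i : dataset_of j) dataset_price p i
    | inr (existT j i) =>
        kappaD m (val i) + SV m (val i) j / (1 + delta m j) * W p j
    end.

Lemma quotation_buyer (p : 'rV[R]_market_dim) (j : 'I_J) (k : buyer_of j) :
  buyer_price (quotation p) k =
  kappaM m j + (1 + delta m j) * \sum_(i : dataset_of j) dataset_price p i.
Proof. by rewrite /buyer_price mxE enum_rankK. Qed.

Lemma quotation_dataset (p : 'rV[R]_market_dim) (j : 'I_J) (i : dataset_of j) :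
  dataset_price (quotation p) i =
  kappaD m (val i) + SV m (val i) j / (1 + delta m j) * W p j.
Proof. by rewrite /dataset_price mxE enum_rankK. Qed.

End Quotation.

(* Main.v *)
(** Both the fixed point and the convergence hold for every standard
    interference function [T]. The coordinatewise infimum of the feasible
    points [p >= T p] is a fixed point [p*], by monotonicity alone. Let [a] be
    the infimum of the [alpha >= 1] such that [p* / alpha <= p_t <= alpha p*]
    for some [t] (hence for all later ones). If [a > 1], scalability is strict
    at [a p*] and at [p* / a]; this leaves enough room to push some iterate
    within a factor [a / gamma], [gamma > 1], of [p*]. So [a = 1], which is
    convergence; uniqueness follows by iterating from another fixed point. *)

Require Import Defs.
From HB Require Import structures.
From mathcomp Require Import all_boot all_order all_algebra.
From mathcomp Require Import all_classical all_reals all_analysis.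
From mathcomp Require Import lra.
Set Implicit Arguments.
Unset Strict Implicit.
Unset Printing Implicit Defensive.
Import Order.TTheory GRing.Theory Num.Theory.
Import numFieldNormedType.Exports.
Local Open Scope classical_set_scope.
Local Open Scope ring_scope.

Lemma vle_trans (R : realType) (d : nat) (y x z : 'rV[R]_d) :
  vle x y -> vle y z -> vle x z.
Proof. by move=> xy yz c; exact: le_trans (xy c) (yz c). Qed.

Lemma vle_anti (R : realType) (d : nat) (x y : 'rV[R]_d) :
  vle x y -> vle y x -> x = y.
Proof. by move=> xy yx; apply/rowP => c; apply/le_anti; rewrite xy yx. Qed.

Lemma vltW (R : realType) (d : nat) (x y : 'rV[R]_d) : vlt x y -> vle x y.
Proof. by move=> xy c; exact/ltW/xy. Qed.

Lemma vle0Z (R : realType) (d : nat) (a : R) (x : 'rV[R]_d) :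
  0 <= a -> vle 0 x -> vle 0 (a *: x).
Proof. by move=> a0 x0 c; have := x0 c; rewrite !mxE; exact: mulr_ge0. Qed.

(** A strict inequality is an open condition on [g], and there are only finitely many coordinates.
    The square pays for the two factors [g] spent in [sif_contract]. *)
Lemma near1_vlt_scale (R : realType) (d : nat) (x y : 'rV[R]_d) :
  vlt x y -> \forall g \near (1 : R)^'+, vlt (g ^+ 2 *: x) y.
Proof.
move=> xy; apply: filter_forall => c.
have cv : g ^+ 2 * x ord0 c @[g --> (1 : R)^'+] --> 1 ^+ 2 * x ord0 c.
  by apply: cvg_at_right_filter; apply: cvgMr_tmp; exact: exprn_continuous.
under eq_near do rewrite mxE.
by apply: cvgr_lt cv _ _; rewrite expr1n mul1r; exact: xy.
Qed.

(** For [a >= 1] and positive vectors: the ball of radius [ln a] around [p] in the Thompson metric,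
    written without division. *)
Definition within_factor (R : realType) (d : nat) (a : R) (p x : 'rV[R]_d) :=
  vle p (a *: x) /\ vle x (a *: p).

Lemma within_factor_ex (R : realType) (d : nat) (p x : 'rV[R]_d) :
  vlt 0 p -> vlt 0 x -> exists2 a, 1 <= a & within_factor a p x.
Proof.
move=> p0 x0.
have ex_scale (u v : 'rV[R]_d) : vlt 0 u ->
    \forall a \near +oo, vle v (a *: u).
  move=> u0; apply: filter_forall => c.
  have uc : 0 < u ord0 c by have := u0 c; rewrite mxE.
  have := nbhs_pinfty_ge (num_real (v ord0 c / u ord0 c)).
  by apply: filterS => a; rewrite mxE ler_pdivrMr.
near (pinfty_nbhs R) => a; exists a.
  by near: a; exact: nbhs_pinfty_ge (num_real _).
by split; near: a; exact: ex_scale.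
Unshelve. all: by end_near. Qed.

Lemma within_factor_le (R : realType) (d : nat) (a b : R) (p x : 'rV[R]_d) :
  vle 0 p -> vle 0 x -> a <= b -> within_factor a p x -> within_factor b p x.
Proof.
move=> p0 x0 ab [px xp]; split.
  apply: vle_trans px _ => c; have := x0 c; rewrite !mxE => xc.
  exact: ler_wpM2r.
apply: vle_trans xp _ => c; have := p0 c; rewrite !mxE => pc.
exact: ler_wpM2r.
Qed.

(** The map is affine with nonnegative coefficients and positive constant terms. Scaling the prices
    by [alpha] scales the linear part exactly, so the gap in scalability is [alpha - 1] times the
    offset. *)
Lemma quotation_standard_interference (R : realType) (l J K : nat)
    (m : market R l J K) : standard_interference_function (@quotation R l J K m).
Proof.
have d1 j : 0 < 1 + delta m j by have := delta_ge0 m j; lra.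
have sv0 j (i : dataset_of m j) : 0 <= SV m (val i) j / (1 + delta m j).
  by rewrite divr_ge0 ?(ltW (d1 j)) // SV_ge0 ?(valP i).
have om0 j (k : buyer_of m j) : 0 <= omega m j (val k).
  by rewrite omega_ge0 ?(valP k).
split.
- move=> x x0 c; have xn e : 0 <= x ord0 e by have := x0 e; rewrite mxE.
  rewrite !mxE; case: (enum_val c) => -[j k].
    apply: ltr_wpDr (kappaM_gt0 m j); apply: mulr_ge0 (ltW (d1 j)) _.
    by apply: sumr_ge0 => i _; exact: xn.
  apply: ltr_wpDr (kappaD_gt0 m _); apply: mulr_ge0 (sv0 j k) _.
  by apply: sumr_ge0 => i _; apply: mulr_ge0 => //; exact: xn.
- move=> x y _ _ yx c; rewrite !mxE; case: (enum_val c) => -[j k].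
    rewrite lerD2l ler_pM2l //; apply: ler_sum => i _; exact: yx.
  rewrite lerD2l; apply: ler_wpM2l => //; apply: ler_sum => i _.
  by apply: ler_wpM2l => //; exact: yx.
- move=> x a x0 a1 c; rewrite !mxE; case: (enum_val c) => -[j k].
    have -> : \sum_(i : dataset_of m j) dataset_price (a *: x) i =
        a * \sum_(i : dataset_of m j) dataset_price x i.
      by rewrite mulr_sumr; apply: eq_bigr => i _; rewrite /dataset_price mxE.
    by rewrite mulrCA [ltRHS]mulrDr ltrD2r ltr_pMl // kappaM_gt0.
  have -> : W (a *: x) j = a * W x j.
    rewrite mulr_sumr; apply: eq_bigr => i _.
    by rewrite /buyer_price mxE mulrCA.
  by rewrite mulrCA [ltRHS]mulrDr ltrD2r ltr_pMl // kappaD_gt0.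
Qed.

(** Knaster-Tarski: the meet [p] of the feasible set [F] lies in [F], hence so does [T p], whence
    [p <= T p]. *)
Lemma monotone_fixed_point (R : realType) (d : nat) (T : 'rV[R]_d -> 'rV[R]_d)
    (pbar : 'rV[R]_d) :
  (forall x, vle 0 x -> vle 0 (T x)) -> monotonicity T ->
  vle 0 pbar -> vle (T pbar) pbar ->
  exists p, vle 0 p /\ p = T p.
Proof.
move=> T0 Tmon pbar0 pbarT.
pose F := [set p | vle 0 p /\ vle (T p) p].
pose p := \row_c inf [set x ord0 c | x in F].
(* With [pbar] in [F], each [inf] is a true greatest lower bound and not the default value. *)
have FN c : [set x ord0 c | x in F] !=set0 by exists (pbar ord0 c), pbar.
have p_le x : F x -> vle p x.
  move=> Fx c; rewrite mxE; apply: ge_inf; last by exists x.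
  by exists 0 => _ [y [y0 _] <-]; have := y0 c; rewrite mxE.
have le_p y : (forall x, F x -> vle y x) -> vle y p.
  move=> yF c; rewrite mxE; apply: lb_le_inf => // _ [x Fx <-].
  exact: yF.
have p0 : vle 0 p by apply: le_p => x [].
have Tp_le : vle (T p) p.
  apply: le_p => x Fx; have [x0 xT] := Fx.
  by apply: vle_trans xT; apply: Tmon => //; exact: p_le.
exists p; split=> //; apply: vle_anti => //; apply: p_le.
by split; [exact: T0 | apply: Tmon => //; exact: T0].
Qed.

(** One [g] serves all [x], since it depends only on the slack at [a p] and [p / a]. The hypothesis
    allows [g * a] rather than [a] because an infimum of factors need not be attained. *)
Lemma sif_contract (R : realType) (d : nat) (T : 'rV[R]_d -> 'rV[R]_d)
    (p : 'rV[R]_d) (a : R) :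
  standard_interference_function T -> vle 0 p -> p = T p -> 1 < a ->
  exists g, [/\ 1 < g, g < a & forall x, vle 0 x ->
    within_factor (g * a) p x -> within_factor (a / g) p (T x)].
Proof.
move=> [_ Tmon Tscal] p0 pT a1.
have a0 : 0 < a by lra.
have T_ap : vlt (T (a *: p)) (a *: p) by rewrite {2}pT; exact: Tscal.
have T_pa : vlt p (a *: T (a^-1 *: p)).
  rewrite {1}pT -{1}[p](scalerKV (lt0r_neq0 a0)); apply: Tscal => //.
  by apply: vle0Z => //; rewrite invr_ge0 ltW.
near (1 : R)^'+ => g.
have g1 : 1 < g by near: g; exact: nbhs_right_gt.
have ga : g < a by near: g; exact: nbhs_right_lt.
have gT_ap : vlt (g ^+ 2 *: T (a *: p)) (a *: p).
  by near: g; exact: near1_vlt_scale.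
have gT_pa : vlt (g ^+ 2 *: p) (a *: T (a^-1 *: p)).
  by near: g; exact: near1_vlt_scale.
have g0 : 0 < g by lra.
exists g; split=> // x x0 [px xp]; split=> c.
(* From [p / a <= g x] follows [T (p / a) <= T (g x) <= g T x]; then
   [g^2 p < a T (p / a) <= a g T x]. *)
- have Tx : vle (T (a^-1 *: p)) (g *: T x).
    apply: vle_trans (vltW (Tscal _ _ x0 g1)); apply: Tmon.
    + exact: vle0Z (ltW g0) x0.
    + by apply: vle0Z => //; rewrite invr_ge0 ltW.
    + move=> e; have := px e; rewrite !mxE => pe.
      by rewrite ler_pdivrMl // mulrCA mulrA.
  have := gT_pa c; have := Tx c; rewrite !mxE.
  rewrite -(ler_pM2l a0) => Txc /ltW /le_trans /(_ Txc).
  rewrite mulrCA expr2 -mulrA ler_pM2l // => h.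
  by rewrite mulrAC ler_pdivlMr // mulrC.
(* Dually, [x <= g a p] gives [T x <= T (g a p) <= g T (a p)], and [g^2 T (a p) < a p]. *)
- have Tx : vle (T x) (g *: T (a *: p)).
    apply: vle_trans (vltW (Tscal _ _ (vle0Z (ltW a0) p0) g1)).
    apply: Tmon => //; last by rewrite scalerA.
    by do 2! [apply: vle0Z; first exact: ltW].
  have := gT_ap c; have := Tx c; rewrite !mxE.
  rewrite -(ler_pM2l g0) mulrA -expr2 => Txc /ltW /(le_trans Txc) h.
  by rewrite mulrAC ler_pdivlMr // mulrC.
Unshelve. all: by end_near. Qed.

(** Weakening [a] to [g * a] before [sif_contract], and [a / g] to [a] after it, shows that the ball
    is stable under [T]. *)
Lemma sif_within_factor (R : realType) (d : nat) (T : 'rV[R]_d -> 'rV[R]_d)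
    (p x : 'rV[R]_d) (a : R) :
  standard_interference_function T -> vle 0 p -> p = T p -> vle 0 x ->
  1 < a -> within_factor a p x -> within_factor a p (T x).
Proof.
move=> Tsif p0 pT x0 a1 px; have [Tpos _ _] := Tsif.
have [g [g1 ga H]] := sif_contract Tsif p0 pT a1.
have [a0 g0] : 0 < a /\ 0 < g by split; exact: lt_trans ltr01 _.
have ga_px : within_factor (g * a) p x.
  by apply: within_factor_le px => //; rewrite ler_peMl ?ltW.
apply: within_factor_le (H x x0 ga_px) => //; first exact/vltW/Tpos.
by rewrite ler_pdivrMr // ler_peMr ?ltW.
Qed.

Lemma sif_iter_within_factor (R : realType) (d : nat)
    (T : 'rV[R]_d -> 'rV[R]_d) (p : 'rV[R]_d) (u : nat -> 'rV[R]_d) (b : R) :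
  standard_interference_function T -> vle 0 p -> p = T p ->
  vle 0 (u 0%N) -> (forall t, u t.+1 = T (u t)) -> 1 < b ->
  exists N, within_factor b p (u N).
Proof.
move=> Tsif p0 pT u0 uT b1; have [Tpos _ _] := Tsif.
have u_ge0 t : vle 0 (u t).
  by elim: t => // t ut; rewrite uT; exact/vltW/Tpos.
pose S := [set a | 1 <= a /\ exists N, within_factor a p (u N)].
have SN : S !=set0.
  (* The index is 1 because [u 0] may have zero coordinates, whereas [u 1] is a value of [T] and so
     positive. *)
  have [||a a1 pa] := @within_factor_ex _ _ p (u 1%N) _ _.
  - by rewrite pT; exact: Tpos.
  - by rewrite uT; exact: Tpos.
  - by exists a; split=> //; exists 1%N.
have S1 : lbound S 1 by move=> a [].
have [inf_b|b_inf] := ltP (inf S) b.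
  have [a [_ [N pN]] ab] := inf_lt SN inf_b.
  by exists N; exact: within_factor_le (ltW ab) pN.
have inf1 : 1 < inf S by exact: lt_le_trans b_inf.
have [g [g1 ga H]] := sif_contract Tsif p0 pT inf1.
have [a0 g0] : 0 < inf S /\ 0 < g by split; exact: lt_trans ltr01 _.
have [||a [a1 [N pN]] ag] := @inf_lt _ S (g * inf S) => //.
  by rewrite ltr_pMl.
(* A member of [S] smaller than its infimum is the contradiction; [g < inf S] keeps it above 1. *)
have : S (inf S / g).
  split; first by rewrite ler_pdivlMr // mul1r ltW.
  exists N.+1; rewrite uT; apply: H => //.
  exact: within_factor_le (ltW ag) pN.
move/(ge_inf (ex_intro _ 1 S1)).
by rewrite ler_pdivlMr // ger_pMr // leNgt g1.
Qed.

Lemma sif_cvg (R : realType) (d : nat) (T : 'rV[R]_d -> 'rV[R]_d)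
    (p : 'rV[R]_d) (u : nat -> 'rV[R]_d) :
  standard_interference_function T -> vle 0 p -> p = T p ->
  vle 0 (u 0%N) -> (forall t, u t.+1 = T (u t)) -> u t @[t --> \oo] --> p.
Proof.
move=> Tsif p0 pT u0 uT; have [Tpos _ _] := Tsif.
have u_ge0 t : vle 0 (u t).
  by elim: t => // t ut; rewrite uT; exact/vltW/Tpos.
apply/cvg_ballP => e e0.
near (1 : R)^'+ => g.
have g1 : 1 < g by near: g; exact: nbhs_right_gt.
(* This controls both sides of the ball: [p - p / g^2 <= g^2 p - p < e] in each coordinate. *)
have gp : vlt (g ^+ 2 *: p) (p + const_mx e).
  by near: g; apply: near1_vlt_scale => c; rewrite !mxE ltrDl.
have gg1 : 1 < g ^+ 2 by rewrite exprn_egt1.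
have [N pN] := sif_iter_within_factor Tsif p0 pT u0 uT gg1.
have pt t : within_factor (g ^+ 2) p (u (t + N)%N).
  elim: t => // t IHt; rewrite addSn uT.
  exact: sif_within_factor.
exists N => //= t /= Nt; split=> // i c; rewrite ord1 {i}.
have [] := pt (t - N)%N; rewrite subnK // => /(_ c) + /(_ c).
have := gp c; have := p0 c; have := u_ge0 t c; rewrite !mxE.
rewrite /ball /= => ? ? ? ? ?; rewrite ltr_distlC; apply/andP; split; nra.
Unshelve. all: by end_near. Qed.

Theorem theorem1 (R : realType) (l J K : nat) (m : market R l J K) :
  standard_interference_function (@quotation R l J K m) /\
  ((exists pbar : 'rV[R]_(market_dim m), vle 0 pbar /\ vle (quotation pbar) pbar) ->
   exists pstar : 'rV[R]_(market_dim m),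
     [/\ vle 0 pstar,
         pstar = quotation pstar,
         (forall q : 'rV[R]_(market_dim m), vle 0 q -> q = quotation q -> q = pstar) &
         (forall p : nat -> 'rV[R]_(market_dim m),
            vle 0 (p 0%N) -> (forall t : nat, p t.+1 = quotation (p t)) ->
            p t @[t --> \oo] --> pstar)]).
Proof.
have Qsif := quotation_standard_interference m.
split=> // -[pbar [pbar0 pbarQ]]; have [Qpos Qmon _] := Qsif.
have [p [p0 pQ]] := monotone_fixed_point
  (fun x x0 => vltW (Qpos x x0)) Qmon pbar0 pbarQ.
exists p; split=> // [q q0 qQ|u u0 uQ]; last exact: sif_cvg Qsif p0 pQ u0 uQ.
(* The constant sequence at [q] is an orbit, so it tends to [p] as well as to [q]. *)
have qp := @sif_cvg _ _ _ p (fun=> q) Qsif p0 pQ q0 (fun=> qQ).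
apply: cvg_unique qp => //.
exact: cvg_cst.
Qed.
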